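(* If $n$ is a positive integer that is not divisible by $3$, then $$W_{3,n}(b,q,t)=\sum_{i=0}^{\lfloor n/3\rfloor} b^i\cdot s_{n-1-2i,i}(q,t),$$ where $W_{3,n}(b,q,t)=\sum_w b^{\mathrm{skip}(w)}q^{\mathrm{dinv}(w)}t^{\mathrm{area}(w)}$ (sum over all $(3,n)$-rank words $w$) and $s_{\lambda}(q,t)$ denotes the Schur function indexed by the partition $\lambda$ evaluated in the two variables $q,t$.
   Context: Set $m=3$, and let $n$ be a positive integer coprime to $3$. Rank words. The $(m,n)$-word is the list, in increasing order, of all positive integers of the form $a=mn-km-\ell n$ with integers $k,\ell\ge1$; each such $a$ is written as the letter $a_\ell$, with rank $a$ and color $\ell$. An $(m,n)$-rank word is the $(m,n)$-word with a subset of its letters highlighted, such that if $mn-km-\ell n$ is highlighted then $mn-im-jn$ is highlighted for all $1\le i\le k$, $1\le j\le \ell$. Statistics on rank words. For a rank word $w$, $\mathrm{area}(w)$ is the number of letters that are not highlighted. Let $S$ be the set of ordered pairs of letters $(a_k,b_\ell)$ with $a_k$ highlighted, $b_\ell$ not highlighted and $a<b$ (i.e. $a_k$ is to the left of $b_\ell$); necessarily $k\neq\ell$. Let $S_<$ (resp. $S_>$) be the subset of pairs with $k<\ell$ (resp. $k>\ell$). Define the equivalence relation $\sim$ on $S$ by $(a_k,b_\ell)\sim(c_r,d_t)$ if and only if either both pairs lie in $S_<$, $k=r$ and $b\equiv d\pmod n$; or both pairs lie in $S_>$, $\ell=t$ and $a\equiv c\pmod n$. Then $\mathrm{skip}(w)=|S/\!\sim|$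 is the number of equivalence classes, and $\mathrm{dinv}(w)=\frac{(n-1)(m-1)}{2}-\mathrm{area}(w)-\mathrm{skip}(w)$, which for $m=3$ is $n-1-\mathrm{area}(w)-\mathrm{skip}(w)$. *)

(* Defs.v *)
From HB Require Import structures.
From mathcomp Require Import all_boot all_order all_algebra.
From mathcomp.multinomials Require Import mpoly.

Set Implicit Arguments.
Unset Strict Implicit.
Unset Printing Implicit Defensive.

Import GRing.Theory.

(* The pair (k, l) stands for the positive integer m * n - k * m - l * n.  The
   bounds k < n and l < m follow from positivity, so no letter is missed.  When
   m and n are coprime distinct pairs have distinct ranks (rank_inj below), so
   this type is in bijection with the letters of the (m, n)-word. *)
Definition letter (m n : nat) : predArgType :=
  {x : 'I_n * 'I_m | [&& 0 < x.1, 0 < x.2 & x.1 * m + x.2 * n < m * n]}.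

Section RankWords.

Variables m n : nat.
Implicit Types (a b c d : letter m n) (w : {set letter m n}).

Definition lk a : nat := (val a).1.
Definition color a : nat := (val a).2.

(* The subtraction is never truncated on letters. *)
Definition rank a : nat := m * n - lk a * m - color a * n.

(* A rank word is given by the set of its highlighted letters; the order of the
   letters in the word is that of their ranks. *)
Definition is_rank_word w : bool :=
  [forall a in w, forall b, (lk b <= lk a) && (color b <= color a) ==> (b \in w)].

Definition area w : nat := #|~: w|.

Definition skip_pairs w : {set letter m n * letter m n} :=
  [set p | [&& p.1 \in w, p.2 \notin w & rank p.1 < rank p.2]].

Definition skip_lt w : {set letter m n * letter m n} :=
  [set p in skip_pairs w | color p.1 < color p.2].

Definition skip_gt w : {set letter m n * letter m n} :=
  [set p in skip_pairs w | color p.1 > color p.2].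

Definition skip_equiv w : rel (letter m n * letter m n) := fun p p' =>
  [&& p \in skip_lt w, p' \in skip_lt w, color p.1 == color p'.1
    & rank p.2 == rank p'.2 %[mod n]]
  || [&& p \in skip_gt w, p' \in skip_gt w, color p.2 == color p'.2
    & rank p.1 == rank p'.1 %[mod n]].

Definition skip w : nat :=
  #|equivalence_partition (skip_equiv w) (skip_pairs w)|.

(* A genuine integer difference; (n - 1)(m - 1) is even when m and n are
   coprime. *)
Definition dinv w : int :=
  (((n.-1 * m.-1) %/ 2)%:Z - (area w)%:Z - (skip w)%:Z)%R.

Definition rank_word_poly (R : comUnitRingType) (b q t : R) : R :=
  (\sum_(w : {set letter m n} | is_rank_word w)
     b ^+ skip w * q ^ dinv w * t ^+ area w)%R.

Lemma rank_inj : coprime m n -> injective rank.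
Proof.
move=> cmn a b; rewrite /rank -!subnDA /lk /color.
case: a => [[k l] /= ha]; case: b => [[k' l'] /= hb] eqr.
have /and3P[/= _ _ lta] := ha; have /and3P[/= _ _ ltb] := hb.
have e : k * m + l * n = k' * m + l' * n.
  by rewrite -(subKn (ltnW lta)) eqr subKn // ltnW.
have el : l = l'.
  have sub (i j : 'I_m) : i <= j -> i * n = j * n %[mod m] -> i = j.
    move=> le /eqP; rewrite eq_sym eqn_mod_dvd ?leq_mul2r ?le ?orbT //.
    rewrite -mulnBl Gauss_dvdl // /dvdn modn_small; last first.
      exact: leq_ltn_trans (leq_subr _ _) (ltn_ord j).
    by rewrite subn_eq0 => ge; apply/val_inj/eqP; rewrite eqn_leq le.
  have := congr1 (modn^~ m) e; rewrite !modnMDl => eqm.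
  by case/orP: (leq_total l l') => ll; [|apply/esym]; apply: sub.
have ek : k = k'.
  move/eqP: e; rewrite el eqn_add2r eqn_pmul2r; first by move/eqP/val_inj.
  exact: leq_ltn_trans (leq0n l) (ltn_ord l).
by apply/val_inj; rewrite /= ek el.
Qed.

End RankWords.

(* Cells of the Young diagram of a partition la (a weakly decreasing sequence,
   possibly with trailing zeros), in English notation. *)
Definition cell (la : seq nat) : predArgType :=
  {x : 'I_(size la) * 'I_(head 0 la) | x.2 < nth 0 la x.1}.

Definition semistandard (N : nat) (la : seq nat)
    (T : {ffun cell la -> 'I_N}) : bool :=
  [forall x : cell la, forall y : cell la,
     (((val x).1 == (val y).1) && ((val x).2 < (val y).2) ==> (T x <= T y))
     && (((val x).2 == (val y).2) && ((val x).1 < (val y).1) ==> (T x < T y))].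

(* Schur function of the partition la evaluated at x, as a sum over
   semistandard tableaux of shape la. *)
Definition schur (R : comNzRingType) (N : nat) (la : seq nat) (x : N.-tuple R) : R :=
  (\sum_(T : {ffun cell la -> 'I_N} | semistandard T) \prod_(c : cell la) tnth x (T c))%R.

(* The exponent dinv is a priori an integer, so the formal identity in the
   indeterminates b, q, t takes place in Q(b, q, t) = Frac Z[b, q, t]. *)
Definition ratfun : fieldType := {fraction {mpoly int[3]}}.
Definition var_b : ratfun := (tofrac ('X_(inord 0) : {mpoly int[3]})).
Definition var_q : ratfun := (tofrac ('X_(inord 1) : {mpoly int[3]})).
Definition var_t : ratfun := (tofrac ('X_(inord 2) : {mpoly int[3]})).

(* Main.v *)
Require Import Defs.
From mathcomp Require Import all_boot all_order all_algebra.
From mathcomp Require Import zify.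

Import GRing.Theory.

(** Write A = floor(n / 3) and B = floor(2n / 3), so that A + B = n - 1.  There
    are B letters of color 1, of ranks 2n - 3k with 1 <= k <= B, and A letters
    of color 2, of ranks n - 3j with 1 <= j <= A.  Closure under decreasing k
    and color means that a rank word highlights the letters k <= x of color 1
    and j <= y of color 2 for a pair with x <= B and y <= min(A, x)
    ([rank_word_staircase]); such pairs index the sum ([sum_rank_words]).

    Both kinds of equivalence classes of skip pairs are determined by the
    color-2 member of the pair, hence skip counts the color-2 letters that
    belong to a skip pair ([card_equivalence_partition_key],
    [color2_member_skip_pairs]).  As n - 3j < 2n - 3k exactly when k - j <= A,
    these are the letters j with x - A < j <= y or y < j < x - A; so, with
    truncated subtractions,
      skip = (y - (x - A)) + (x - A - 1 - y),
      area = n - 1 - x - y  and  dinv = x + y - skip.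

    The pair (skip, dinv) determines (x, y), and runs exactly over the pairs
    (i, p) with i <= A and i <= p <= n - 1 - 2i.  Indeed the words with skip i
    form three families:
      (x, y) = (p, i) with i <= p <= A has dinv p;
      (x, y) = (A + h, i + h) with h >= 1 has dinv A + 2h;
      (x, y) = (A + 1 + i + h, h) with h >= 0 has dinv A + 1 + 2h;
    their dinv fill the interval [i, A] and then the two parities above A
    ([staircase_ofK], [skip_dinv_staircase_of]).

    On the other side, a semistandard tableau with two rows of lengths
    l1 >= l2 and entries in {0, 1} is determined by its number p of zeros,
    l2 <= p <= l1, so s_(l1, l2)(q, t) is the sum of q^p t^(l1 + l2 - p)
    ([schur_two_rows]).  For (l1, l2) = (n - 1 - 2i, i) this is the sum over
    the words of skip i, since area = n - 1 - i - dinv. *)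

(** * Schur polynomials of two rows in two variables *)

Section Schur.

Local Open Scope ring_scope.
Variables (l1 l2 : nat).
Hypothesis l21 : (l2 <= l1)%N.

Local Notation cell := (cell [:: l1; l2]).
Implicit Types (c d : cell) (T : {ffun cell -> 'I_2}).

Definition row c : nat := (val c).1.
Definition col c : nat := (val c).2.

Lemma cell_cases c : (row c = 0 \/ row c = 1) /\ (col c < if row c == 0 then l1 else l2)%N.
Proof.
case: c => [[r j] h]; rewrite /row /col /=.
by case: r h => [[|[|r]] hr] //= h; split; auto.
Qed.

Lemma exists_cell r j : (r < 2)%N -> (j < if r == 0 then l1 else l2)%N ->
  exists c, row c = r /\ col c = j.
Proof.
move=> r2 hj; have j1 : (j < l1)%N by move: hj; case: ifP => //; lia.
pose x : 'I_(size [:: l1; l2]) * 'I_(head 0 [:: l1; l2])%N := (Ordinal r2, Ordinal j1).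
have h : (x.2 < nth 0 [:: l1; l2] x.1)%N by case: r r2 hj @x => [|[|r]].
by exists (exist _ x h).
Qed.

(** The tableau with p zeros: they start row 0, and every other entry is 1. *)
Definition two_row_tableau (p : nat) : {ffun cell -> 'I_2} :=
  [ffun c => if (row c == 0) && (col c < p)%N then ord0 else ord_max].

(** The bound l2 <= p makes the columns strict: every cell of row 1 lies below
    one of the p zeros. *)
Lemma two_row_tableau_semistandard p : (l2 <= p)%N ->
  semistandard (two_row_tableau p).
Proof.
move=> lp; apply/forallP => c; apply/forallP => d.
have [rc cc] := cell_cases c; have [rd cd] := cell_cases d.
have -> : ((val c).1 == (val d).1) = (row c == row d) by [].
have -> : ((val c).2 == (val d).2) = (col c == col d) by [].
rewrite !ffunE -/(row c) -/(row d) -/(col c) -/(col d).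
move: rc cc rd cd => [] -> /= cc [] -> /= cd;
  by case: (ltnP (col c) p); case: (ltnP (col d) p) => /=; lia.
Qed.

Lemma semistandardP T : semistandard T ->
  (forall c d, row c = row d -> (col c < col d)%N -> (T c <= T d)%N) /\
  (forall c d, col c = col d -> (row c < row d)%N -> (T c < T d)%N).
Proof.
move=> /forallP ss; split=> c d e h;
  have /forallP/(_ d)/andP[/implyP h1 /implyP h2] := ss c.
  by apply: h1; rewrite h andbT; apply/eqP/val_inj.
by apply: h2; rewrite h andbT; apply/eqP/val_inj.
Qed.

(** Strict columns force the first l2 columns to read 0 above 1, hence row 1
    consists of ones; weak rows make the zeros an initial segment of row 0. *)
Lemma semistandard_two_row T : semistandard T ->
  exists p, (l2 <= p <= l1)%N /\ T = two_row_tableau p.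
Proof.
move=> /semistandardP[ssr ssc].
(* The zeros being an initial segment of row 0, p is also their number. *)
pose p := \max_(c | T c == ord0) (col c).+1.
have T0 c : row c = 0 -> (col c < l2)%N -> T c = ord0.
  move=> r0 cl; have [|d [rd cd]] := @exists_cell 1 (col c) isT; first by [].
  have := ssc c d; rewrite r0 rd cd => /(_ erefl isT).
  by case: (T c) (T d) => [[|[]]//= ?] [[|[|?]]//= ?] _; apply: val_inj.
have R1 c : row c = 1 -> T c = ord_max.
  move=> r1; have [_] := cell_cases c; rewrite r1 /= => cl.
  have [|d [rd cd]] := @exists_cell 0 (col c) isT; first by rewrite /=; lia.
  have := ssc d c; rewrite r1 rd cd => /(_ erefl isT).
  by case: (T c) (T d) => [[|[|?]]//= ?] [[|[|?]]//= ?] _; apply: val_inj.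
have p1 : (p <= l1)%N.
  apply/bigmax_leqP => c _; have [_] := cell_cases c.
  by case: ifP => // _; lia.
have p2 : (l2 <= p)%N.
  have [->//|l20] := posnP l2.
  have [|d [rd cd]] := @exists_cell 0 l2.-1 isT; first by rewrite /=; lia.
  rewrite -(prednK l20) -cd.
  apply: (@leq_bigmax_cond _ (fun c => T c == ord0) (fun c => (col c).+1)).
  by rewrite T0 // cd prednK.
exists p; split; first by rewrite p2.
apply/ffunP => c; rewrite ffunE; have [[r0|r1] _] := cell_cases c; last by rewrite R1 // r1.
rewrite r0 /=; case: ltnP => [cp|pc]; last first.
  apply/eqP; move: pc; rewrite leqNgt; apply: contraNT => Tc.
  apply: (@leq_bigmax_cond _ (fun c => T c == ord0) (fun c => (col c).+1)).
  by move: Tc; rewrite -!val_eqE /=; case: (T c) => [[|[|?]]].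
have : (0 < #|[pred c | T c == ord0]|)%N.
  by rewrite lt0n; apply: contraL cp => /eqP/card0_eq e; rewrite /p big_pred0.
move=> /(eq_bigmax_cond (fun c => (col c).+1))[d /eqP Td e].
have rd : row d = 0 by have [[//|/R1]] := cell_cases d; rewrite Td.
move: cp; rewrite /p e ltnS leq_eqVlt => /orP[/eqP ecd|ecd].
  suff -> : c = d by [].
  apply/val_inj/eqP; rewrite -pair_eqE /pair_eq -!val_eqE /=.
  by rewrite -/(row c) -/(row d) -/(col c) -/(col d) ecd r0 rd !eqxx.
have := ssr c d; rewrite r0 rd Td => /(_ erefl ecd).
by rewrite leqn0 => /eqP h; apply: val_inj.
Qed.

Lemma two_row_tableau_inj : {in [pred p | p <= l1]%N &, injective two_row_tableau}.
Proof.
suff lt p p' : (p < p' <= l1)%N -> two_row_tableau p <> two_row_tableau p'.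
  move=> p p'; rewrite !inE => h h' e; case: (ltngtP p p') => // l.
    by case: (lt p p'); rewrite ?l.
  by case: (lt p' p); rewrite ?l.
move=> /andP[pp' p'l] /ffunP e.
have [|c [rc cc]] := @exists_cell 0 p isT; first exact: leq_trans p'l.
by have := e c; rewrite !ffunE rc cc ltnn pp'.
Qed.

Context {R : comNzRingType}.

Lemma two_row_tableau_weight (q t : R) p : (l2 <= p <= l1)%N ->
  \prod_(c : cell) tnth [tuple q; t] (two_row_tableau p c)
  = q ^+ p * t ^+ (l1 + l2 - p).
Proof.
move=> /andP[lp pl].
pose G (r : 'I_2) (j : 'I_l1) := if (r == 0 :> nat) && (j < p)%N then q else t.
transitivity (\prod_(r < 2) \prod_(j < l1 | (j < nth 0 [:: l1; l2] r)%N) G r j).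
  rewrite pair_big_dep /=.
  rewrite (big_sub [pred x : 'I_2 * 'I_l1 | (x.2 < nth 0 [:: l1; l2] x.1)%N]).
  apply: eq_bigr => c _; rewrite ffunE /G /row /col.
  by case: ifP => _; rewrite !(tnth_nth 0).
rewrite !big_ord_recl big_ord0 mulr1 /G /=.
rewrite (eq_bigl xpredT) => [|j]; last by rewrite ltn_ord.
rewrite (eq_bigr (fun=> t) (P := fun j : 'I_l1 => (j < l2)%N)) //.
rewrite -(big_ord_widen l1 (fun=> t) l21) prodr_const card_ord.
rewrite -(big_mkord xpredT (fun j => if (j < p)%N then q else t)).
rewrite (big_cat_nat (leq0n p) pl) /=.
rewrite (eq_big_nat _ _ (F2 := fun=> q)) => [|j /andP[_ ->]] //.
rewrite (eq_big_nat (m := p) _ _ (F2 := fun=> t)) => [|j /andP[pj _]]; last first.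
  by rewrite ltnNge pj.
by rewrite !prodr_const_nat subn0 -mulrA -exprD addnBAC.
Qed.

Lemma schur_two_rows (q t : R) :
  schur [:: l1; l2] [tuple q; t] =
  \sum_(l2 <= p < l1.+1) q ^+ p * t ^+ (l1 + l2 - p).
Proof.
rewrite big_geq_mkord /schur /=.
pose tab (p : 'I_l1.+1) := two_row_tableau p.
transitivity (\sum_(T in tab @: [pred p : 'I_l1.+1 | (l2 <= p)%N])
    \prod_(c : cell) tnth [tuple q; t] (T c)).
  apply: eq_bigl => T; apply/idP/imsetP.
    move=> /semistandard_two_row[p [/andP[lp pl] ->]].
    by exists (inord p); rewrite ?inE /tab inordK.
  by case=> p lp ->; apply: two_row_tableau_semistandard.
rewrite big_imset => [|p p' _ _ e]; last first.
  by apply/val_inj/(two_row_tableau_inj _ _ (ltn_ord p) (ltn_ord p') e).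
apply: eq_bigr => p lp; rewrite two_row_tableau_weight //.
by apply/andP; split=> //; apply: leq_ord.
Qed.

End Schur.

(** * Letters of a fixed color *)

Section Letters.

Context {m n : nat}.
Implicit Types c d : letter m n.

Lemma letter_bounds c :
  [/\ 0 < lk c, 0 < color c & lk c * m + color c * n < m * n].
Proof. by case: c => x h; apply/and3P. Qed.

Lemma exists_letter k l : 0 < k -> 0 < l -> k * m + l * n < m * n ->
  exists c : letter m n, lk c = k /\ color c = l.
Proof.
move=> k0 l0 h; have kn : k < n by nia.
have lm : l < m by nia.
pose x := (Ordinal kn, Ordinal lm).
have hx : [&& 0 < x.1, 0 < x.2 & x.1 * m + x.2 * n < m * n] by rewrite /= k0 l0.
by exists (exist _ x hx).
Qed.

Lemma letter_inj c d : lk c = lk d -> color c = color d -> c = d.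
Proof.
case: c d => [[k l] h] [[k' l'] h']; rewrite /lk /color /= => /val_inj e /val_inj e'.
by apply: val_inj; rewrite /= e e'.
Qed.

(** Letters of a fixed color l correspond to the k >= 1 with k m < m n - l n,
    so counting them is counting in an interval of integers. *)
Lemma card_letters_of_color l (P : pred nat) : 0 < l -> l < m -> 0 < n ->
  #|[set c : letter m n | (color c == l) && P (lk c)]|
  = count P (iota 1 ((m * n - l * n).-1 %/ m)).
Proof.
move=> l0 lm n0; rewrite cardE -(size_map (@lk m n)) -size_filter.
apply/perm_size/uniq_perm; last 1 first.
- move=> k; rewrite mem_filter mem_iota; apply/mapP/andP.
    case=> c; rewrite mem_enum inE => /andP[/eqP cl Pk] ->; split=> //.
    have [k0 _] := letter_bounds c; rewrite cl => h.
    by rewrite k0 ltnS leq_divRL //; lia.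
  case=> Pk /andP[k0]; rewrite ltnS leq_divRL; last by lia.
  move=> h.
  have [||| c [ck cl]] := @exists_letter k l; [by []|by []|nia|].
  by exists c => //; rewrite mem_enum inE cl eqxx ck.
- rewrite map_inj_in_uniq ?enum_uniq // => c d.
  rewrite !mem_enum !inE => /andP[/eqP cl _] /andP[/eqP dl _] e.
  by apply: letter_inj => //; rewrite cl dl.
- by rewrite filter_uniq // iota_uniq.
Qed.

End Letters.

(** * Two counting lemmas *)

Lemma count_iota_interval u v N :
  count (fun j => u < j <= v) (iota 1 N) = minn N v - u.
Proof.
elim: N => [|N IH]; first by rewrite min0n sub0n.
by rewrite -[X in iota _ X]addn1 iotaD count_cat IH /= addn0 add1n; lia.
Qed.

(** If R is equality of keys on S, its classes are the nonempty fibers of the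
    key. *)
Lemma card_equivalence_partition_key {T U : finType} (key : T -> U)
    (R : rel T) (S : {set T}) :
  {in S &, forall x y, R x y = (key x == key y)} ->
  #|equivalence_partition R S| = #|key @: S|.
Proof.
move=> RK; pose fiber u := [set y in S | key y == u].
have -> : equivalence_partition R S = fiber @: (key @: S).
  rewrite -imset_comp; apply: eq_in_imset => x xS /=.
  apply/setP => y; rewrite !inE; case yS: (y \in S) => //=.
  by rewrite RK // eq_sym.
rewrite card_in_imset // => _ _ /imsetP[x xS ->] /imsetP[y yS ->] e.
have : x \in fiber (key x) by rewrite inE xS eqxx.
by rewrite e inE => /andP[_ /eqP].
Qed.

(** * Rank words with three rows as pairs of integers *)

Section ThreeRankWords.

Context {n : nat}.
Hypothesis n_ndvd3 : ~~ (3 %| n).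

Local Notation A := (n %/ 3).
Local Notation B := ((2 * n) %/ 3).
Local Notation letter := (letter 3 n).
Implicit Types (c d : letter) (w : {set letter}).

Let n_gt0 : 0 < n.
Proof. by case: n n_ndvd3. Qed.

Lemma color_cases c : color c = 1 \/ color c = 2.
Proof. by have [_ l0 h] := letter_bounds c; nia. Qed.

Lemma lk_bound c : lk c <= if color c == 1 then B else A.
Proof.
by have [_ _] := letter_bounds c; case: (color_cases c) => ->; rewrite /=; lia.
Qed.

Lemma exists_letter1 k : 0 < k <= B -> exists c, lk c = k /\ color c = 1.
Proof. by move=> h; apply: exists_letter; lia. Qed.

Lemma card_color1 (P : pred nat) :
  #|[set c : letter | (color c == 1) && P (lk c)]| = count P (iota 1 B).
Proof. by rewrite card_letters_of_color //; congr (count _ (iota _ _)); lia. Qed.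

Lemma card_color2 (P : pred nat) :
  #|[set c : letter | (color c == 2) && P (lk c)]| = count P (iota 1 A).
Proof. by rewrite card_letters_of_color //; congr (count _ (iota _ _)); lia. Qed.

Definition staircase (x y : nat) : {set letter} :=
  [set c | lk c <= if color c == 1 then x else y].

Lemma staircase_rank_word x y : y <= x -> is_rank_word (staircase x y).
Proof.
move=> yx; apply/forallP => a; apply/implyP; rewrite inE => ha.
apply/forallP => b; apply/implyP => /andP[hk hl]; rewrite inE.
by case: (color_cases a) (color_cases b) ha hk hl => -> [] -> /=; lia.
Qed.

Lemma rank_word_staircase w : is_rank_word w ->
  exists x y, [/\ x <= B, y <= A, y <= x & w = staircase x y].
Proof.
move=> /forallP rw.
have down a b : a \in w -> lk b <= lk a -> color b <= color a -> b \in w.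
  by move=> aw hk hl; have /implyP/(_ aw)/forallP/(_ b) := rw a; rewrite hk hl.
(* h 1 is x and h 2 is y; that the maximum defining h 1 includes the
   letters of color 2 makes y <= x immediate. *)
pose h l := \max_(c in w | l <= color c) lk c.
have hP l c : color c = l -> (c \in w) = (lk c <= h l).
  move=> cl; apply/idP/idP => [cw|]; first by apply: leq_bigmax_cond; rewrite cw cl leqnn.
  have [k0 _ _] := letter_bounds c => ck.
  have : 0 < #|[pred d | (d \in w) && (l <= color d)]|.
    rewrite lt0n; apply: contraL ck => /eqP/card0_eq e; rewrite /h big_pred0 //.
    by rewrite leqn0 -lt0n.
  move=> /(eq_bigmax_cond (@lk 3 n))[d /andP[dw dl] e].
  by apply: (down d) => //; [rewrite -e | rewrite cl].
have h2A : h 2 <= A.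
  apply/bigmax_leqP => c /andP[_]; have := lk_bound c.
  by case: (color_cases c) => ->.
have h1B : h 1 <= B.
  apply/bigmax_leqP => c _; have := lk_bound c; case: ifP => //; lia.
exists (h 1), (h 2); split=> //; last first.
  by apply/setP => c; rewrite inE; case: (color_cases c) => e; rewrite (hP _ _ e) e.
apply/bigmax_leqP => c /andP[cw c2]; apply: leq_bigmax_cond; rewrite cw /=; lia.
Qed.

(** With [staircase_card2], this recovers x and y from the word, so distinct
    pairs within the bounds give distinct words. *)
Lemma staircase_card1 x y : x <= B ->
  #|[set c | (color c == 1) && (c \in staircase x y)]| = x.
Proof.
move=> xB; rewrite -[RHS](_ : minn B x - 0 = x); last by lia.
rewrite -count_iota_interval.
rewrite -card_color1; apply: eq_card => c; rewrite !inE.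
have [k0 _ _] := letter_bounds c; rewrite k0 /=.
by case: eqP => // ->.
Qed.

Lemma staircase_card2 x y : y <= A ->
  #|[set c | (color c == 2) && (c \in staircase x y)]| = y.
Proof.
move=> yA; rewrite -[RHS](_ : minn A y - 0 = y); last by lia.
rewrite -count_iota_interval.
rewrite -card_color2; apply: eq_card => c; rewrite !inE.
have [k0 _ _] := letter_bounds c; rewrite k0 /=.
by case: eqP => // ->.
Qed.

Lemma area_staircase x y : x <= B -> y <= A ->
  area (staircase x y) = n.-1 - (x + y).
Proof.
move=> xB yA; rewrite /area -(cardsID [set c | color c == 1]).
have -> : ~: staircase x y :&: [set c | color c == 1]
        = [set c | (color c == 1) && (x < lk c <= B)].
  apply/setP => c; rewrite !inE -ltnNge; have := lk_bound c.
  by case: eqP => _ h; rewrite ?andbF // h !andbT.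
have -> : ~: staircase x y :\: [set c | color c == 1]
        = [set c | (color c == 2) && (y < lk c <= A)].
  apply/setP => c; rewrite !inE -ltnNge; have := lk_bound c.
  by case: (color_cases c) => -> //= h; rewrite h andbT.
rewrite (card_color1 (fun j => x < j <= B)) (card_color2 (fun j => y < j <= A)).
by rewrite !count_iota_interval; lia.
Qed.

(** * The statistics of a rank word *)

(** The ranks of the letters of color 2 lie strictly between 0 and n, so
    reduction modulo n does not identify any of them. *)
Lemma rank_mod_inj2 c d : color c = 2 -> color d = 2 ->
  (rank c == rank d %[mod n]) = (c == d).
Proof.
move=> c2 d2; have [k0 _] := letter_bounds c; have [k0' _] := letter_bounds d.
rewrite c2 d2 => hd hc; rewrite !modn_small; [|rewrite /rank ?c2 ?d2; lia..].
apply/eqP/eqP => [e|-> //]; apply: letter_inj; last by rewrite c2 d2.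
by move: e; rewrite /rank c2 d2; lia.
Qed.

Lemma rank_ltE c d :
  (rank c < rank d) =
  (lk d * 3 + color d * n < lk c * 3 + color c * n).
Proof.
have [_ _ hc] := letter_bounds c; have [_ _ hd] := letter_bounds d.
by rewrite /rank; apply/idP/idP; lia.
Qed.

(** The two members of a skip pair have different colors; this picks the one of
    color 2. *)
Definition color2_member (p : letter * letter) : letter :=
  if color p.1 == 2 then p.1 else p.2.

Lemma skip_pair_colors x y p : p \in skip_pairs (staircase x y) ->
  (color p.1 = 1 /\ color p.2 = 2) \/ (color p.1 = 2 /\ color p.2 = 1).
Proof.
rewrite inE !inE rank_ltE; case: (color_cases p.1) (color_cases p.2) => -> [] -> //=; lia.
Qed.

(** In a pair of [skip_lt] the member of color 2 is not highlighted, in a pair of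
    [skip_gt] it is; so the key separates the two kinds of pairs, and within
    each kind it determines the class by [rank_mod_inj2]. *)
Lemma skip_equiv_color2_member x y :
  {in skip_pairs (staircase x y) &, forall p p',
    skip_equiv (staircase x y) p p' = (color2_member p == color2_member p')}.
Proof.
move=> p p' pS pS'; have ltE u : (u \in skip_lt (staircase x y)) =
    (u \in skip_pairs (staircase x y)) && (color u.1 < color u.2) by rewrite [LHS]in_set.
have gtE u : (u \in skip_gt (staircase x y)) =
    (u \in skip_pairs (staircase x y)) && (color u.1 > color u.2) by rewrite [LHS]in_set.
rewrite /skip_equiv !ltE !gtE pS pS' /color2_member.
have [/and3P[p1 p2 _] /and3P[p1' p2' _]] :
  [&& p.1 \in staircase x y, p.2 \notin staircase x y & rank p.1 < rank p.2]
  /\ [&& p'.1 \in staircase x y, p'.2 \notin staircase x y & rank p'.1 < rank p'.2].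
  by move: pS pS'; rewrite !(in_set (fun p => [&& _, _ & _])).
case: (skip_pair_colors _ _ _ pS) (skip_pair_colors _ _ _ pS') => [] [e1 e2] [] [e1' e2'];
  rewrite e1 e2 e1' e2' /= ?orbF.
- exact: rank_mod_inj2.
- by apply/esym/negbTE; apply: contraNneq p2 => ->.
- by apply/esym/negbTE; apply: contraNneq p2' => <-.
- exact: rank_mod_inj2.
Qed.

(** A highlighted color-2 letter j has an unhighlighted color-1 letter on its
    right iff the rightmost candidate k = x + 1 satisfies k - j <= A (which
    forces k <= 2A <= B, so that this letter exists); an unhighlighted one has a
    highlighted color-1 letter on its left iff the leftmost candidate k = x
    satisfies k - j > A. *)
Lemma color2_member_skip_pairs x y : x <= B -> y <= A ->
  color2_member @: skip_pairs (staircase x y) =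
  [set c | (color c == 2) &&
     ((x - A < lk c <= y) || (y < lk c <= x - A.+1))].
Proof.
move=> xB yA; apply/setP => c; rewrite inE; apply/imsetP/idP.
  case=> p pS ->; move: (pS); rewrite inE !inE rank_ltE /color2_member.
  have := lk_bound p.1; have := lk_bound p.2.
  have [k1 _ _] := letter_bounds p.1; have [k2 _ _] := letter_bounds p.2.
  move: k1 k2; case: (skip_pair_colors _ _ _ pS) => [] [e1 e2]; rewrite e1 e2 /= ?e1 ?e2;
    by move: (lk p.1) (lk p.2) => ? ? ? ? ? ? /and3P[]; lia.
move=> /andP[/eqP c2 /orP[/andP[h h']|/andP[h h']]].
- have [|d [kd d1]] := exists_letter1 x.+1; first by lia.
  exists (c, d); last by rewrite /color2_member /= c2.
  by rewrite inE !inE rank_ltE /= c2 d1 kd /=; lia.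
- have [|d [kd d1]] := exists_letter1 x; first by lia.
  exists (d, c); last by rewrite /color2_member /= d1.
  by rewrite inE !inE rank_ltE /= c2 d1 kd /=; lia.
Qed.

Definition skip_of (x y : nat) : nat := (y - (x - A)) + (x - A.+1 - y).

Definition dinv_of (x y : nat) : nat := x + y - skip_of x y.

Lemma skip_staircase x y : x <= B -> y <= A ->
  skip (staircase x y) = skip_of x y.
Proof.
move=> xB yA; rewrite /skip /skip_of.
rewrite (card_equivalence_partition_key _ _ _ (skip_equiv_color2_member x y)).
rewrite color2_member_skip_pairs //.
rewrite (card_color2 (fun j => (x - A < j <= y) || (y < j <= x - A.+1))).
(* One of the two intervals is empty. *)
have [yx|xy] := leqP y (x - A).
  rewrite (@eq_count _ _ (fun j => y < j <= x - A.+1)) => [|j]; last by apply/idP/idP; lia.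
  by rewrite count_iota_interval; lia.
rewrite (@eq_count _ _ (fun j => x - A < j <= y)) => [|j]; last by apply/idP/idP; lia.
by rewrite count_iota_interval; lia.
Qed.

Local Open Scope ring_scope.

Lemma dinv_staircase x y : (x <= B)%N -> (y <= A)%N ->
  dinv (staircase x y) = dinv_of x y.
Proof.
move=> xB yA; rewrite /dinv skip_staircase // area_staircase // /dinv_of.
have : (skip_of x y <= x + y)%N by rewrite /skip_of; lia.
have : (x + y <= n.-1)%N by lia.
have -> : (n.-1 * 3.-1 %/ 2 = n.-1)%N by lia.
by move: (skip_of x y) => s; lia.
Qed.

Lemma sum_rank_words (V : nmodType) (F : {set letter} -> V) :
  \sum_(w | is_rank_word w) F w =
  \sum_(u : 'I_B.+1 * 'I_A.+1 | (u.2 <= u.1)%N) F (staircase u.1 u.2).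
Proof.
pose word (u : 'I_B.+1 * 'I_A.+1) := staircase u.1 u.2.
rewrite -[RHS](big_imset F (h := word)
  (A := [pred u : 'I_B.+1 * 'I_A.+1 | (u.2 <= u.1)%N])).
  apply: eq_bigl => w; apply/idP/imsetP.
    move=> /rank_word_staircase[x [y [xB yA yx ->]]].
    by exists (inord x, inord y); rewrite ?inE /word /= !inordK.
  by case=> u yx ->; apply: staircase_rank_word.
move=> [x y] [x' y'] _ _ e.
have := staircase_card1 _ y (leq_ord x); have := staircase_card2 x _ (leq_ord y).
move: e; rewrite /word /= => ->.
rewrite staircase_card1 ?staircase_card2 ?leq_ord // => ey ex.
by congr (_, _); apply: val_inj.
Qed.

(** * Words against pairs (skip, dinv) *)

(** The rank word with skip i and dinv p: above A the parity of p - A tells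
    whether y < x - A. *)
Definition staircase_of (i p : nat) : nat * nat :=
  (let h := (p - A) %/ 2 in
  if p <= A then (p, i)
  else if odd (p - A) then (A.+1 + i + h, h) else (A + h, i + h))%N.

Lemma staircase_ofK x y : (x <= B -> y <= A -> y <= x ->
  staircase_of (skip_of x y) (dinv_of x y) = (x, y) /\
  skip_of x y <= dinv_of x y <= n - 1 - 2 * skip_of x y /\ skip_of x y <= A)%N.
Proof.
rewrite /staircase_of /dinv_of /skip_of => xB yA yx; split; last by lia.
by do 2?case: ifP => ?; congr (_, _); lia.
Qed.

Lemma skip_dinv_staircase_of i p : (i <= A -> i <= p <= n - 1 - 2 * i ->
  let: (x, y) := staircase_of i p in
  [/\ x <= B, y <= A, y <= x, skip_of x y = i & dinv_of x y = p])%N.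
Proof.
move=> iA ip; rewrite /staircase_of /dinv_of /skip_of.
by do 2?case: ifP => ?; split; lia.
Qed.

Lemma sum_staircases (V : nmodType) (F : nat -> nat -> V) :
  \sum_(u : 'I_B.+1 * 'I_A.+1 | (u.2 <= u.1)%N)
     F (skip_of u.1 u.2) (dinv_of u.1 u.2) =
  \sum_(0 <= i < A.+1) \sum_(i <= p < (n - 1 - 2 * i).+1) F i p.
Proof.
rewrite big_mkord.
rewrite [RHS](eq_bigr (fun i : 'I_A.+1 =>
  \sum_(p < n.-1.+1 | (i <= p <= n - 1 - 2 * i)%N) F i p)); last first.
  move=> i _; rewrite big_geq_mkord (big_ord_widen_cond n.-1.+1); last by lia.
  by apply: eq_bigl => p; rewrite ltnS.
rewrite pair_big_dep /=.
pose stair (j : 'I_A.+1 * 'I_n.-1.+1) : 'I_B.+1 * 'I_A.+1 :=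
  (inord (staircase_of j.1 j.2).1, inord (staircase_of j.1 j.2).2).
pose stat (u : 'I_B.+1 * 'I_A.+1) : 'I_A.+1 * 'I_n.-1.+1 :=
  (inord (skip_of u.1 u.2), inord (dinv_of u.1 u.2)).
have statE (u : 'I_B.+1 * 'I_A.+1) : (u.2 <= u.1)%N ->
    stair (stat u) = u /\ ((stat u).1 <= (stat u).2 <= n - 1 - 2 * (stat u).1)%N.
  case: u => x y /= yx; rewrite /stair /stat.
  have [||e [ip iA]] := @staircase_ofK x y _ _ yx; try by rewrite -ltnS.
  by rewrite /= !inordK ?e /= ?inord_val ?ip //; lia.
rewrite (reindex_onto stair stat) => [|u /statE[]//].
apply: eq_big => [[i p]|[i p] /andP[h /eqP e]] /=.
  apply/idP/idP => [/andP[h /eqP e]|ip].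
    by have [_] := statE (stair (i, p)) h; rewrite e.
  have /= := skip_dinv_staircase_of i p (ltn_ord i) ip.
  rewrite /stair /stat /=; case: staircase_of => x y [xB yA yx es ed].
  by rewrite /= !inordK // yx es ed !inord_val eqxx.
have [_ ip] := statE (stair (i, p)) h; rewrite e /= in ip.
have /= := skip_dinv_staircase_of i p (ltn_ord i) ip.
rewrite /stair /=; case: staircase_of => x y [xB yA yx es ed].
by rewrite /= !inordK // es ed.
Qed.

(** The identity holds whether or not q is invertible, because dinv is a natural
    number. *)
Lemma rank_word_poly3 (R : comUnitRingType) (b q t : R) :
  rank_word_poly 3 n b q t =
  \sum_(0 <= i < A.+1) b ^+ i * schur [:: n - 1 - 2 * i; i]%N [tuple q; t].
Proof.
pose F i p := b ^+ i * (q ^+ p * t ^+ (n - 1 - 2 * i + i - p)).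
transitivity (\sum_(0 <= i < A.+1) \sum_(i <= p < (n - 1 - 2 * i).+1) F i p).
  rewrite -sum_staircases /rank_word_poly sum_rank_words.
  apply: eq_bigr => -[[x xB] [y yA]] /= yx; move: xB yA; rewrite !ltnS => xB yA.
  rewrite skip_staircase // area_staircase // dinv_staircase // -exprnP -mulrA.
  rewrite /F; congr (_ * (_ * t ^+ _)).
  have [_ [_ sA]] := staircase_ofK _ _ xB yA yx.
  have : (skip_of x y <= x + y)%N by rewrite /skip_of; lia.
  by move: sA; rewrite /dinv_of; move: (skip_of x y) => s; lia.
apply: eq_big_nat => i /andP[_ iA].
by rewrite schur_two_rows ?big_distrr //; lia.
Qed.

End ThreeRankWords.

Theorem theorem2 (n : nat) (n_gt0 : 0 < n) (n_ndvd3 : ~~ (3 %| n)) :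
  rank_word_poly 3 n var_b var_q var_t =
  (\sum_(0 <= i < (n %/ 3).+1)
     var_b ^+ i * schur [:: n - 1 - 2 * i; i]%N [tuple var_q; var_t])%R.
Proof. exact: rank_word_poly3. Qed.
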